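(* Let $f:\mathbb{R}^n\to\mathbb{R}$ be differentiable and let $\rho\ge 0$. Suppose $f$ and $P$ are proper and lower semi-continuous, $P$ is $\rho$-weakly convex, $x\mapsto f(x)-\frac{\rho}{2}\|x\|_2^2$ is convex, and for some $\sigma>0$, $$\|\nabla f(x)-\nabla f(y)\|_2\le\sigma\|x-y\|_2\quad\text{for all }x,y\in\mathbb{R}^n.$$ Suppose also that the set of minimizers of $D(x)=f(x)+P(x)$ is non-empty. If $0<\alpha<2/(\sigma+\rho)$, then for any starting point $x^0\in\mathbb{R}^n$ the iterates $$x^{k+1}=T_\alpha\bigl(x^k-\alpha\nabla f(x^k)\bigr),\qquad k\ge0,$$ converge to a minimizer of $D$.
   Context: A function $h:\mathbb{R}^n\to\mathbb{R}$ is $\rho$-weakly convex (with $\rho\ge 0$) if $x\mapsto \frac{s}{2}\|x\|_2^2+h(x)$ is convex whenever $s\ge\rho$. For $\alpha>0$, the threshold operator associated with $P$ is $T_\alpha(z)=\arg\min_{x}\ \frac{1}{2\alpha}\|x-z\|_2^2+P(x)$; it is well-defined (unique minimizer) when this minimization problem is strictly convex, which is the case here since $\alpha\rho<1$. *)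

(* Defs.v *)
From HB Require Import structures.
From mathcomp Require Import all_boot all_order all_algebra.
From mathcomp Require Import all_classical all_reals all_analysis.
Import Order.TTheory GRing.Theory Num.Theory.
Import numFieldNormedType.Exports.

Set Implicit Arguments.
Unset Strict Implicit.
Unset Printing Implicit Defensive.

Local Open Scope classical_set_scope.
Local Open Scope ring_scope.

(* The library norm `|x| on row vectors is the sup norm. *)
Definition norm2 (R : realType) (n : nat) (x : 'rV[R]_n) : R :=
  Num.sqrt (\sum_(i < n) x 0 i ^+ 2).

Definition gradient (R : realType) (n : nat) (f : 'rV[R]_n -> R)
    (x : 'rV[R]_n) : 'rV[R]_n :=
  \row_(i < n) 'D_(delta_mx 0 i) f x.

Definition proper_function (R : realType) (n : nat)
    (h : 'rV[R]_n -> \bar R) : Prop :=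
  (forall x, (-oo < h x)%E) /\ (exists x, (h x < +oo)%E).

(* Extended-valued counterpart of the library's real-valued [convex_function];
   meant for functions that avoid -oo (the library sets +oo + -oo = -oo).
   Since 0 * +oo = 0, the cases t = 0 and t = 1 hold trivially. *)
Definition convex_efunction (R : realType) (n : nat)
    (h : 'rV[R]_n -> \bar R) : Prop :=
  forall (t : R) (x y : 'rV[R]_n), 0 <= t <= 1 ->
    (h (t *: x + (1 - t) *: y)%R <= t%:E * h x + (1 - t)%:E * h y)%E.

Lemma convex_efunction_EFin (R : realType) (n : nat) (f : 'rV[R]_n -> R) :
  convex_efunction (EFin \o f) <->
  convex_function [set: convex_lmodType 'rV[R]_n] f.
Proof.
split=> [cf t x y _ _|cf t x y /andP[t0 t1]].
  have /(cf _ x y) : 0 <= t%:num <= 1 by rewrite ge0 le1.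
  by rewrite /= lee_fin.
have := cf (Itv01 t0 t1) x y (in_setT _) (in_setT _).
by rewrite /= lee_fin.
Qed.

Definition weakly_convex (R : realType) (n : nat) (rho : R)
    (h : 'rV[R]_n -> \bar R) : Prop :=
  forall s : R, rho <= s ->
    convex_efunction (fun x => (s / 2 * norm2 x ^+ 2)%:E + h x)%E.

Definition minimizers (R : realType) (n : nat)
    (h : 'rV[R]_n -> \bar R) : set 'rV[R]_n :=
  [set x | forall y, (h x <= h y)%E].

(* [get] selects a point of the set of minimizers; its value is junk if that
   set is empty. *)
Definition threshold (R : realType) (n : nat) (P : 'rV[R]_n -> \bar R)
    (alpha : R) (z : 'rV[R]_n) : 'rV[R]_n :=
  get (minimizers
    (fun x => ((1 / (2 * alpha)) * norm2 (x - z)%R ^+ 2)%:E + P x)%E).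

(* Main.v *)
Require Import Defs.
From HB Require Import structures.
From mathcomp Require Import all_boot all_order all_algebra.
From mathcomp Require Import all_classical all_reals all_analysis.
From mathcomp Require Import lra.
Import Order.TTheory GRing.Theory Num.Theory.
Import numFieldNormedType.Exports.

Local Open Scope classical_set_scope.
Local Open Scope ring_scope.

(** Moving the quadratic [rho / 2 * |.|^2] from [f] to [P] splits [D] into two
    convex functions, [g = f - rho / 2 * |.|^2] and [Q = P + rho / 2 * |.|^2].
    When [alpha * rho < 1], one step of the iteration is one forward-backward
    step [x -> prox_(beta Q) (x - beta grad g x)] with
    [beta = alpha / (1 - alpha rho)].  The gradient of [g] is Lipschitz with
    constant [sigma - rho], and [alpha < 2 / (sigma + rho)] is exactly
    [beta (sigma - rho) < 2], the classical step-size condition.  The condition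
    [alpha * rho < 1] itself follows from [rho <= sigma], which holds as soon as
    the space is not trivial ([modulus_le_lipschitz]).

    The subdifferential of [Q] is handled through weak subgradients of [P]:
    vectors [v] with [P u >= P y + <v, u - y> - rho / 2 |u - y|^2] for all [u].
    A point [s] minimizes [D] if and only if [- grad f s] is a weak subgradient
    of [P] at [s], and the prox step produces one at the new iterate
    ([threshold_weak_subgradient]).  The minimum defining the threshold operator
    is attained because a weak subgradient of [P], available at a minimizer of
    [D], makes the prox objective coercive.

    Monotonicity of weak subgradients and the cocoercivity of [grad g]
    ([cocoercive]) give, for every minimizer [s] and a constant [k > 1],
    [k |x_(j+1) - s|^2 <= k |x_j - s|^2 - (k - 1) |x_j - x_(j+1)|^2]
    ([forward_backward_fejer]).  Hence distances to minimizers decrease and the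
    steps tend to [0].  Weak subgradients pass to the limit because [P] is lower
    semicontinuous ([weak_subgradient_closed]), so every cluster point of the
    bounded sequence minimizes [D]; the distance to such a cluster point is
    nonincreasing and arbitrarily small, so the whole sequence converges to it
    ([fejer_cvg]). *)

(** * The Euclidean inner product *)

Definition dot {R : realType} {n : nat} (x y : 'rV[R]_n) : R :=
  \sum_(i < n) x 0 i * y 0 i.

Section dot.
Context {R : realType} {n : nat}.
Implicit Types x y z : 'rV[R]_n.

Lemma dotC x y : dot x y = dot y x.
Proof. by apply: eq_bigr => i _; rewrite mulrC. Qed.

Lemma dotDl x y z : dot (x + y) z = dot x z + dot y z.
Proof. by rewrite -big_split; apply: eq_bigr => i _; rewrite mxE mulrDl. Qed.

Lemma dotZl a x z : dot (a *: x) z = a * dot x z.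
Proof. by rewrite mulr_sumr; apply: eq_bigr => i _; rewrite mxE mulrA. Qed.

Lemma dot0l x : dot 0 x = 0.
Proof. by rewrite -(scale0r 0) dotZl mul0r. Qed.

Lemma dotNl x z : dot (- x) z = - dot x z.
Proof. by rewrite -scaleN1r dotZl mulN1r. Qed.

Lemma dotDr x y z : dot z (x + y) = dot z x + dot z y.
Proof. by rewrite dotC dotDl !(dotC z). Qed.

Lemma dotZr a x z : dot z (a *: x) = a * dot z x.
Proof. by rewrite dotC dotZl dotC. Qed.

Lemma dotNr x z : dot z (- x) = - dot z x.
Proof. by rewrite dotC dotNl dotC. Qed.

Definition dotE := (dotDl, dotDr, dotNl, dotNr, dotZl, dotZr).

Lemma dotxx_ge0 x : 0 <= dot x x.
Proof. by apply: sumr_ge0 => i _; exact: sqr_ge0. Qed.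

(** Trades [norm2] for the bilinear [dot], on which the estimates reduce to
    linear arithmetic. *)
Lemma sqr_norm2 x : norm2 x ^+ 2 = dot x x.
Proof. by rewrite sqr_sqrtr ?dotxx_ge0. Qed.

Lemma sqr_coord_le_dotxx x i : x 0 i ^+ 2 <= dot x x.
Proof.
rewrite /dot (bigD1 i)//= expr2 lerDl.
by apply: sumr_ge0 => j _; exact: sqr_ge0.
Qed.

Lemma cvg_dot {T : Type} {F : set_system T} {FF : Filter F}
    (u v : T -> 'rV[R]_n) (a b : 'rV[R]_n) :
  u @ F --> a -> v @ F --> b -> dot (u t) (v t) @[t --> F] --> dot a b.
Proof.
move=> ua vb; apply: cvg_big => [|i _].
  by move=> i; exact: add_continuous.
apply: cvgM.
  exact: (cvg_comp _ _ ua (@coord_continuous _ _ _ 0 i a)).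
exact: (cvg_comp _ _ vb (@coord_continuous _ _ _ 0 i b)).
Qed.

(** The topology of row vectors is that of the sup norm, which is dominated by
    the Euclidean norm coordinate by coordinate. *)
Lemma cvg_dotxx0 {T : Type} {F : set_system T} {FF : Filter F}
    (u : T -> 'rV[R]_n) (a : 'rV[R]_n) :
  dot (u t - a) (u t - a) @[t --> F] --> 0 -> u @ F --> a.
Proof.
move=> ua; apply/cvgrPdist_lt => e e0.
have e20 : 0 < e ^+ 2 by rewrite exprn_gt0.
near=> t.
have : ball a e (u t).
  split=> // i j; rewrite (ord1 i) /ball/=.
  rewrite -(@ltr_pXn2r _ 2) ?nnegrE ?(ltW e0)// real_normK ?num_real//.
  rewrite -sqrrN opprB.
  have := sqr_coord_le_dotxx (u t - a) j; rewrite !mxE => /le_lt_trans; apply.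
  rewrite -[ltLHS]ger0_norm ?dotxx_ge0//.
  by near: t; move/cvgr0Pnorm_lt : ua; apply.
by rewrite -ball_normE.
Unshelve. all: by end_near. Qed.

End dot.

(** * The descent inequality for a Lipschitz gradient *)

Section descent.
Context {R : realType} {n : nat}.
Implicit Types (f : 'rV[R]_n -> R) (x y e : 'rV[R]_n).

Lemma derive_gradient f x e : differentiable f x ->
  'D_e f x = dot (gradient f x) e.
Proof.
move=> fx; rewrite deriveE// {1}[e]row_sum_delta linear_sum.
apply: eq_bigr => i _; rewrite linearZ mxE deriveE// mulrC.
by congr (_ * _).
Qed.

(** The difference quotients of [s |-> f (x + s *: e)] at [t] are, term for term,
    those defining the directional derivative of [f] at [x + t *: e]. *)
Lemma is_derive_segment f x e (t : R) : differentiable f (x + t *: e) ->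
  is_derive t 1 (fun s => f (x + s *: e)) (dot (gradient f (x + t *: e)) e).
Proof.
move=> fx.
have E : (fun h : R => h^-1 *: (((fun s => f (x + s *: e)) \o shift t) (h *: 1) -
      f (x + t *: e))) =
    (fun h => h^-1 *: ((f \o shift (x + t *: e)) (h *: e) - f (x + t *: e))).
  apply/funext => h /=; congr (_ *: (f _ - _)).
  by rewrite [h *: 1]mulr1 scalerDl addrCA.
split.
  by rewrite /derivable E; exact: diff_derivable.
by rewrite /derive E -derive_gradient.
Qed.

(** Young's inequality with weight [s], for [x] and for [- x]; it does the work
    of the Cauchy-Schwarz inequality without leaving squared norms. *)
Lemma normr_dot_le x e (s : R) : 0 < s ->
  dot x x <= s ^+ 2 * dot e e -> `|dot x e| <= s * dot e e.
Proof.
move=> s0 xe.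
have := dotxx_ge0 (x - s *: e); have := dotxx_ge0 (x + s *: e).
rewrite !dotE !(dotC e) => H1 H2.
by rewrite ler_norml; apply/andP; split; rewrite -(ler_pM2l s0); lra.
Qed.

Lemma gradient_segment_le f (sigma : R) x e (t : R) : 0 < sigma -> 0 < t ->
  (forall x y, norm2 (gradient f x - gradient f y) <= sigma * norm2 (x - y)) ->
  `|dot (gradient f (x + t *: e) - gradient f x) e| <= sigma * t * dot e e.
Proof.
move=> s0 t0 lip; apply: normr_dot_le; first exact: mulr_gt0.
have := lip (x + t *: e) x; rewrite [x + _ - x]addrAC subrr add0r => dle.
rewrite -[leLHS]sqr_norm2.
apply: le_trans (_ : (sigma * norm2 (t *: e)) ^+ 2 <= _).
  by rewrite lerXn2r// nnegrE ?(le_trans _ dle) ?sqrtr_ge0.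
by rewrite exprMn sqr_norm2 !dotE; lra.
Qed.

(** The mean value theorem is applied to the difference of both sides along the
    segment.  Its derivative at [t] is
    [<grad f (x + t e) - grad f x, e> - sigma t |e|^2 <= 0], which gives the
    sharp factor [1 / 2]. *)
Lemma descent f (sigma : R) x e : 0 < sigma ->
  (forall x, differentiable f x) ->
  (forall x y, norm2 (gradient f x - gradient f y) <= sigma * norm2 (x - y)) ->
  f (x + e) <= f x + dot (gradient f x) e + sigma / 2 * dot e e.
Proof.
move=> s0 df lip; set m := dot e e.
pose h (t : R) := f (x + t *: e) - (t * dot (gradient f x) e
   + sigma / 2 * m * t ^+ 2).
pose h' (t : R) := dot (gradient f (x + t *: e)) e - (dot (gradient f x) e
   + sigma * m * t).
have hd (t : R) : is_derive t 1 h (h' t).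
  have fd := @is_derive_segment f x e t (df _).
  rewrite /h; apply: is_derive_eq.
  by rewrite /h' /GRing.scale/=; lra.
have hc : {within `[0, 1], continuous h}.
  by apply: derivable_within_continuous => t _; exact: ex_derive.
have [t /itvP t01] := MVT ltr01 (fun t _ => hd t) hc.
have t0 : 0 < t by rewrite t01.
rewrite subr0 mulr1 /h /h' scale1r scale0r addr0 => hE.
suff le0 : dot (gradient f (x + t *: e) - gradient f x) e <= sigma * t * m.
  move: le0 hE; rewrite dotDl dotNl; lra.
apply: le_trans (ler_norm _) _; exact: gradient_segment_le.
Qed.

End descent.

(** * Strong convexity and cocoercivity *)

(** Stands for dividing by [t] and letting [t] tend to [0] in first-order
    optimality arguments. *)
Lemma le0_of_quadratic_bound {R : realType} (a b : R) :
  (forall t, 0 < t <= 1 -> t * a <= t ^+ 2 * b) -> a <= 0.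
Proof.
move=> H; rewrite leNgt; apply/negP => a0.
have b0 := normr_ge0 b; have bb := ler_norm b.
have ab : 0 < a + `|b| by lra.
have t0 : 0 < a / (a + `|b|) by rewrite divr_gt0.
(* this t is at most 1 and satisfies t * b < a when 0 < a *)
have := H (a / (a + `|b|)).
rewrite t0 ler_pdivrMr// mul1r lerDl b0 => /(_ isT).
rewrite expr2 -mulrA ler_pM2l// -[_ * b]mulrAC ler_pdivlMr// mulrDr; nra.
Qed.

Lemma dotDE {R : realType} {n : nat} (x e : 'rV[R]_n) (t : R) :
  dot (x + t *: e) (x + t *: e) = dot x x + 2 * t * dot x e + t ^+ 2 * dot e e.
Proof. by rewrite !dotE (dotC e); lra. Qed.

Section strong_convexity.
Context {R : realType} {n : nat} (f : 'rV[R]_n -> R) (rho sigma : R).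
Implicit Types (x y e : 'rV[R]_n).
Context (f_diff : forall x, differentiable f x).
Context (f_sconvex : convex_function [set: convex_lmodType 'rV[R]_n]
  (fun x : 'rV[R]_n => f x - rho / 2 * norm2 x ^+ 2)).
Context (sigma_gt0 : 0 < sigma).
Context (f_lip : forall x y,
  norm2 (gradient f x - gradient f y) <= sigma * norm2 (x - y)).

(** Convexity bounds [f] from above on the segment from [x] to [x + e], and the
    descent inequality read backwards from [x + t e] bounds it from below; the
    two bounds are compared as [t] tends to [0]. *)
Lemma gradient_ineq x e :
  f x + dot (gradient f x) e + rho / 2 * dot e e <= f (x + e).
Proof.
suff : f x + dot (gradient f x) e + rho / 2 * dot e e - f (x + e) <= 0 by lra.
apply: (@le0_of_quadratic_bound _ _ ((3 * sigma + rho) / 2 * dot e e)) => t t01.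
have t_gt0 : 0 < t by lra.
have t01' : 0 <= t <= 1 by lra.
have /convex_efunction_EFin/(_ t (x + e) x t01') := f_sconvex.
rewrite /= -!EFinM -EFinD lee_fin !sqr_norm2.
have -> : t *: (x + e) + (1 - t) *: x = x + t *: e.
  by rewrite scalerDr scalerBl scale1r addrC -addrA addKr.
have E := dotDE x e 1; rewrite scale1r in E; rewrite E dotDE.
have := descent f sigma (x + t *: e) (- (t *: e)) sigma_gt0 f_diff f_lip.
rewrite addrK.
suff : dot (gradient f x - gradient f (x + t *: e)) e <= sigma * t * dot e e.
  by move=> /(ler_wpM2l (ltW t_gt0)); rewrite !dotE; lra.
rewrite -[dot _ _]opprK -dotNl opprB; apply: le_trans (ler_norm _) _.
rewrite normrN; apply: gradient_segment_le => //; lra.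
Qed.

(** Here [d] is the increment of the gradient of [g = f - rho / 2 |.|^2] from [x]
    to [x + e].  At the point [x + e - tau d], the function [g] is above its
    tangent at [x] and below its descent bound at [x + e].  The
    step [tau] is left free, so that [sigma = rho] needs no separate
    treatment. *)
Lemma bregman_ge_sqr_gradient x e d (tau : R) :
  d = gradient f (x + e) - gradient f x - rho *: e ->
  f x + dot (gradient f x) e + rho / 2 * dot e e
    + (tau - (sigma - rho) / 2 * tau ^+ 2) * dot d d <= f (x + e).
Proof.
move=> dE.
have := gradient_ineq x (e + (- tau) *: d).
have := descent f sigma (x + e) ((- tau) *: d) sigma_gt0 f_diff f_lip.
rewrite addrA dotDE.
have : dot d d = dot (gradient f (x + e)) d - dot (gradient f x) d - rho * dot e d.
  by rewrite {1}dE !dotE.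
move=> /(congr1 ( *%R tau)); rewrite !dotE; lra.
Qed.

(** The Baillon-Haddad inequality for [f - rho / 2 |.|^2]: the sum of the previous
    inequality from [x] to [x + e] and back.  When [rho < sigma],
    [tau = 1 / (sigma - rho)] is the usual form. *)
Lemma cocoercive x e d (tau : R) :
  d = gradient f (x + e) - gradient f x - rho *: e ->
  (2 * tau - (sigma - rho) * tau ^+ 2) * dot d d <= dot d e.
Proof.
move=> dE.
have := bregman_ge_sqr_gradient _ _ _ tau dE.
have : - d = gradient f (x + e - e) - gradient f (x + e) - rho *: (- e).
  by rewrite dE addrK scalerN !opprD !opprK [- gradient _ _ + _]addrC.
move/(bregman_ge_sqr_gradient _ _ _ tau); rewrite addrK.
have : dot d e = dot (gradient f (x + e)) e - dot (gradient f x) e - rho * dot e e.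
  by rewrite {1}dE !dotE.
rewrite !dotE; lra.
Qed.
End strong_convexity.

(** * Weak subgradients *)

Section weak_subgradient.
Context {R : realType} {n : nat} (rho : R) (P : 'rV[R]_n -> \bar R).
Implicit Types (x y u v : 'rV[R]_n).

(** Equivalently, [v + rho *: y] is a subgradient at [y] of the convex function
    [P + rho / 2 |.|^2]. *)
Definition weak_subgradient y v :=
  exists2 r, P y = r%:E & forall u,
    ((r + dot v (u - y) - rho / 2 * dot (u - y) (u - y))%:E <= P u)%E.

Lemma weak_subgradient_monotone y1 v1 y2 v2 :
  weak_subgradient y1 v1 -> weak_subgradient y2 v2 ->
  - rho * dot (y1 - y2) (y1 - y2) <= dot (v1 - v2) (y1 - y2).
Proof.
move=> [r1 P1 H1] [r2 P2 H2].
have := H1 y2; have := H2 y1; rewrite P1 P2 !lee_fin -[y2 - y1]opprB.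
by set e := y1 - y2; move: e => e; rewrite !dotE; lra.
Qed.

(** First-order optimality: [y] is compared with [y + t (u - y)], using weak
    convexity for [P] and the quadratic upper model for [F], as [t] tends
    to [0].  It is used both for [f] and for the quadratic term of the threshold
    operator. *)
Lemma weak_subgradient_of_minimizer (F : 'rV[R]_n -> R) y a (c : R) :
  proper_function P -> weakly_convex rho P ->
  minimizers (fun u => (F u)%:E + P u)%E y ->
  (forall e, F (y + e) <= F y + dot a e + c * dot e e) ->
  weak_subgradient y (- a).
Proof.
move=> [Pgt [u0 Pu0]] wc ymin Fle.
have [ry Py] : exists r, P y = r%:E.
  have := ymin u0; have := Pgt y; case: (P y) => [r _ _|//|//]; first by exists r.
  by move=> _; rewrite addey// leye_eq; move: Pu0; case: (P u0).
exists ry => // u.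
have := Pgt u; case Pu : (P u) => [r|//|//] _; last exact: leey.
rewrite lee_fin.
have uE : u = y + (u - y) by rewrite addrC subrK.
move: (u - y) uE => e uE; rewrite {}uE in Pu.
suff : - dot a e - (r - ry) - rho / 2 * dot e e <= 0 by rewrite dotNl; lra.
apply: (@le0_of_quadratic_bound _ _ ((c - rho / 2) * dot e e)) => t t01.
have t01' : 0 <= t <= 1 by lra.
have := wc rho (lexx _) t (y + e) y t01'.
have -> : t *: (y + e) + (1 - t) *: y = y + t *: e.
  by rewrite scalerDr scalerBl scale1r addrC -addrA addKr.
have := ymin (y + t *: e); have := Fle (t *: e).
rewrite Pu Py; case: (P (y + t *: e)) (Pgt (y + t *: e)) => [s _|//|//].
rewrite /= -!EFinD !lee_fin !sqr_norm2.
have E := dotDE y e 1; rewrite scale1r in E; rewrite E dotDE !dotE; lra.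
Qed.

(** The quadratic growth of [F] compensates the quadratic defect of [P]. *)
Lemma minimizer_of_weak_subgradient (F : 'rV[R]_n -> R) y a :
  weak_subgradient y (- a) ->
  (forall e, F y + dot a e + rho / 2 * dot e e <= F (y + e)) ->
  minimizers (fun u => (F u)%:E + P u)%E y.
Proof.
move=> [r Py H] leF u.
have := leF (u - y); have := H u; rewrite [y + _]addrC subrK Py.
case: (P u) => [s|_ _|//]; last by rewrite addey// leey.
by rewrite -!EFinD !lee_fin dotNl; lra.
Qed.

End weak_subgradient.

(** * Minimizing lower semicontinuous functions *)

Lemma lte_between {R : realType} (a : R) (x : \bar R) :
  (a%:E < x)%E -> exists2 b : R, a < b & (b%:E < x)%E.
Proof.
case: x => [r|_|//].
  by rewrite lte_fin => ar; exists ((a + r) / 2); rewrite ?lte_fin; lra.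
by exists (a + 1); [lra | exact: ltry].
Qed.

Section lsc.
Context {R : realType}.

Lemma lower_semicontinuous_addl {T : topologicalType} (F : T -> R) (h : T -> \bar R) :
  continuous F -> lower_semicontinuous h ->
  lower_semicontinuous (fun x => (F x)%:E + h x)%E.
Proof.
move=> cF hl x a ax.
have [b ab bx] : exists2 b : R, a - F x < b & (b%:E < h x)%E.
  apply: lte_between; move: ax; case: (h x) => [r|_|//]; last exact: ltry.
  by rewrite -EFinD !lte_fin; lra.
have [V xV Vb] := hl x b bx.
have e0 : 0 < b - (a - F x) by lra.
exists (V `&` [set y | `|F x - F y| < b - (a - F x)]).
  by apply: filterI => //; move/cvgrPdist_lt : (cF x); apply.
move=> y [/Vb by_ /=]; rewrite ltr_norml => /andP[_ Fy].
case: (h y) by_ => [r|_|//].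
  by rewrite -EFinD !lte_fin; lra.
by rewrite addey// ltry.
Qed.

Lemma seq_min {T : eqType} (h : T -> \bar R) (s : seq T) : s != [::] ->
  exists2 y, y \in s & forall z, z \in s -> (h y <= h z)%E.
Proof.
elim: s => [//|x [|x' s] IH _].
  by exists x; rewrite ?inE// => z; rewrite inE => /eqP ->.
have [//|y ys ymin] := IH.
have [xy|yx] := leP (h x) (h y).
  exists x; rewrite ?mem_head// => z; rewrite in_cons => /predU1P[->//|/ymin].
  exact: le_trans.
exists y; first by rewrite in_cons ys orbT.
by move=> z; rewrite in_cons => /predU1P[->|/ymin//]; exact: ltW.
Qed.

(** If no point of [K] were a minimizer, the open sets [h y < h x] for [y] in [K]
    would cover [K]; but the best [y] of a finite subcover lies in none of its
    sets. *)
Lemma lower_semicontinuous_compact_min {T : ptopologicalType} (K : set T)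
    (h : T -> \bar R) : (forall x, -oo < h x)%E -> lower_semicontinuous h ->
  compact K -> K !=set0 -> exists2 y, K y & forall z, K z -> (h y <= h z)%E.
Proof.
move=> hgt /lower_semicontinuousP hl + [x0 Kx0].
rewrite compact_cover => cK; apply: contrapT => nomin.
have [|x Kx|D DK Kcov] := cK T K (fun y => [set x | h y < h x]%E).
- move=> y _; case: (h y) (hgt y) => [r _|_|//]; first exact: hl.
  suff -> : [set x | +oo < h x]%E = set0 by exact: open0.
  by apply/seteqP; split => // z /=; rewrite ltNge leey.
- apply: contrapT => nx; apply: nomin; exists x => // z Kz.
  by rewrite leNgt; apply/negP => zx; apply: nx; exists z.
have [y yD ymin] : exists2 y, y \in finmap.enum_fset D &
    forall z, z \in finmap.enum_fset D -> (h y <= h z)%E.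
  apply: seq_min; have [z /= zD _] := Kcov _ Kx0.
  have {}zD : z \in finmap.enum_fset D := zD.
  by apply: contraTneq zD => ->.
have [z /= zD] := Kcov y (set_mem (DK _ yD)).
by rewrite ltNge ymin.
Qed.

Lemma continuous_dot_sub {n : nat} (y : 'rV[R]_n) :
  continuous (fun u : 'rV[R]_n => dot (u - y) (u - y)).
Proof.
have uy (u : 'rV[R]_n) : v - y @[v --> u] --> u - y.
  exact: (cvgB cvg_id (cvg_cst y)).
by move=> u; exact: (cvg_dot _ _ _ _ (uy u) (uy u)).
Qed.

Lemma compact_ball2 {n : nat} (y : 'rV[R]_n) (M : R) :
  compact [set u | dot (u - y) (u - y) <= M].
Proof.
have cl : closed [set u : 'rV[R]_n | dot (u - y) (u - y) <= M].
  apply: (@preimage_closed 'rV[R]_n R (fun u => dot (u - y) (u - y))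
    [set x | x <= M]) => [u _|]; last exact: closed_le.
  exact: continuous_dot_sub.
apply: (@subclosed_compact _ _ [set u : 'rV[R]_n | forall i,
    `[y 0 i - (1 + M), y 0 i + (1 + M)]%classic (u 0 i)]) => //.
- apply: (@rV_compact R n (fun i => `[y 0 i - (1 + M), y 0 i + (1 + M)]%classic)).
  by move=> i; exact: segment_compact.
- move=> u /= uM i; have := le_trans (sqr_coord_le_dotxx (u - y) i) uM.
  rewrite !mxE in_itv/=; set a := u 0 i; set b := y 0 i => H.
  have := sqr_ge0 (a - b - 1); have := sqr_ge0 (a - b + 1); have := sqr_ge0 (a - b).
  by move=> *; apply/andP; split; lra.
Qed.

End lsc.

(** * The threshold operator *)

Section threshold.
Context {R : realType} {n : nat} (rho alpha : R) (P : 'rV[R]_n -> \bar R).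
Context (P_proper : proper_function P).
Context (P_lsc : lower_semicontinuous P).
Context (alpha_gt0 : 0 < alpha).
Context (alpha_rho : alpha * rho < 1).

Let half_invE : 1 / (2 * alpha) = alpha^-1 / 2.
Proof. by rewrite mul1r invfM mulrC. Qed.

(** The weak subgradient [v] bounds the objective from below by a quadratic in
    [u - y] with leading coefficient [(1 / alpha - rho) / 2 > 0].  Outside a large
    enough ball around [y] the objective is thus at least its value at [y], and
    the minimum over the ball is a global one. *)
Lemma threshold_minimizes (z y v : 'rV[R]_n) : weak_subgradient rho P y v ->
  minimizers (fun x => ((1 / (2 * alpha)) * norm2 (x - z)%R ^+ 2)%:E + P x)%E
    (threshold P alpha z).
Proof.
move=> [r Py yv]; set phi := fun x => _.
suff /getPex : minimizers phi !=set0 by [].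
pose b := alpha^-1 *: (y - z) + v; pose m := alpha^-1 - rho.
have m0 : 0 < m by rewrite subr_gt0 -(ltr_pM2l alpha_gt0) divff ?gt_eqF.
have phi_gt x : (-oo < phi x)%E.
  by rewrite /phi/= ltNye adde_eq_ninfty negb_or /= -ltNye P_proper.1.
have phi_lsc : lower_semicontinuous phi.
  apply: lower_semicontinuous_addl => //.
  rewrite [X in continuous X](_ : _ = fun x => 1 / (2 * alpha) * dot (x - z) (x - z)).
    by move=> x; exact: (cvgM (cvg_cst _) (continuous_dot_sub z x)).
  by apply/funext => x; rewrite sqr_norm2.
(* [m / 2 * |e|^2 + <b, e>] is nonnegative as soon as [|e|^2 >= M] *)
pose M := 4 * dot b b / m ^+ 2.
have [|w Kw wmin] :=
  lower_semicontinuous_compact_min _ _ phi_gt phi_lsc (compact_ball2 y M).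
  by exists y => /=; rewrite subrr dot0l !mulr_ge0 ?invr_ge0 ?sqr_ge0 ?dotxx_ge0.
exists w => u.
have [uM|Mu] := leP (dot (u - y) (u - y)) M; first exact: wmin.
have Ky : [set u | dot (u - y) (u - y) <= M] y.
  by rewrite /= subrr dot0l !mulr_ge0 ?invr_ge0 ?sqr_ge0 ?dotxx_ge0.
apply: le_trans (wmin y Ky) _; have := yv u; rewrite /phi Py.
case: (P u) => [s|_|//]; last by rewrite addey// leey.
rewrite -!EFinD !lee_fin !sqr_norm2.
have -> : u - z = (y - z) + 1 *: (u - y) by rewrite scale1r [RHS]addrC addrA subrK.
rewrite dotDE; move: (u - y) Mu => e.
rewrite /M ltr_pdivrMr ?exprn_gt0// => Mu.
suff : 0 <= m / 2 * dot e e + dot b e.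
  have -> : dot b e = alpha^-1 * dot (y - z) e + dot v e.
    by rewrite /b (dotDl (_ *: _)) dotZl.
  by rewrite /m half_invE; lra.
have := dotxx_ge0 (b + (m / 2) *: e); rewrite dotDE => b2.
by rewrite -(pmulr_rge0 _ m0); lra.
Qed.

Lemma threshold_weak_subgradient (z y v : 'rV[R]_n) : weakly_convex rho P ->
  weak_subgradient rho P y v ->
  weak_subgradient rho P (threshold P alpha z)
    (- (alpha^-1 *: (threshold P alpha z - z))).
Proof.
move=> wc /(threshold_minimizes z).
move/(weak_subgradient_of_minimizer rho P _ _ _ (alpha^-1 / 2)); apply => // e.
rewrite !sqr_norm2; set t := threshold P alpha z.
rewrite addrAC -[t - z + e]/(t - z + e) -{1 2}[e]scale1r dotDE dotZl.
by rewrite half_invE; lra.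
Qed.

End threshold.

(** * Passing to the limit *)

Lemma cvg_dot_sub {R : realType} {n : nat} {T : Type} {F : set_system T}
    {FF : Filter F} (u : T -> 'rV[R]_n) (a : 'rV[R]_n) :
  u @ F --> a -> dot (u t - a) (u t - a) @[t --> F] --> 0.
Proof.
move=> ua; have ua0 : u t - a @[t --> F] --> (0 : 'rV[R]_n).
  by rewrite -(subrr a); exact: (cvgB ua (cvg_cst a)).
have := cvg_dot _ _ _ _ ua0 ua0.
rewrite dot0l; exact.
Qed.

(** In [P (y t) <= P u - <v t, u - y t> + rho / 2 |u - y t|^2], the right-hand
    side converges and lower semicontinuity bounds [P a] by its limit.  Applied to
    one [u] where [P] is finite, this also shows that [P a] is finite. *)
Lemma weak_subgradient_closed {R : realType} {n : nat} (rho : R)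
    (P : 'rV[R]_n -> \bar R) {T : Type} {F : set_system T} {FF : ProperFilter F}
    (y v : T -> 'rV[R]_n) (a b : 'rV[R]_n) :
  (forall x, -oo < P x)%E -> lower_semicontinuous P ->
  y @ F --> a -> v @ F --> b ->
  (forall t, weak_subgradient rho P (y t) (v t)) -> weak_subgradient rho P a b.
Proof.
move=> Pgt P_lsc ya vb yv.
have H u s : P u = s%:E ->
    (P a <= (s - dot b (u - a) + rho / 2 * dot (u - a) (u - a))%:E)%E.
  move=> Pu; rewrite leNgt; apply/negP => /lte_between [c cgt /P_lsc [V aV Vc]].
  have uy : u - y t @[t --> F] --> u - a.
    exact: (cvgB (cvg_cst u) ya).
  have lim : s - dot (v t) (u - y t) + rho / 2 * dot (u - y t) (u - y t) @[t --> F]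
      --> s - dot b (u - a) + rho / 2 * dot (u - a) (u - a).
    have c1 : s - dot (v t) (u - y t) @[t --> F] --> s - dot b (u - a).
      exact: (cvgB (cvg_cst s) (cvg_dot _ _ _ _ vb uy)).
    have c2 : rho / 2 * dot (u - y t) (u - y t) @[t --> F]
        --> rho / 2 * dot (u - a) (u - a).
      exact: (cvgM (cvg_cst _) (cvg_dot _ _ _ _ uy uy)).
    exact: (cvgD c1 c2).
  have FV : F (y @^-1` V) by exact: ya.
  have [t [yV tc]] := filter_ex (filterI FV (cvgr_lt _ lim _ cgt)).
  have [r Pr /(_ u)] := yv t; have := Vc _ yV; rewrite Pr Pu lte_fin lee_fin.
  by move: tc => /=; lra.
have [t _] := filter_ex (@filterT _ F _).
have [r Pr _] := yv t.
have [q Pa] : exists q, P a = q%:E.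
  by have := H _ _ Pr; have := Pgt a; case: (P a) => // q; exists q.
exists q => // u; have := Pgt u; case Pu : (P u) => [s|//|//] _; last exact: leey.
by have := H _ _ Pu; rewrite Pa !lee_fin; lra.
Qed.

Section fejer.
Context {R : realType} {n : nat} (x : nat -> 'rV[R]_n).

Lemma cluster_often (y : 'rV[R]_n) (N : nat) (e : R) : cluster (x @ \oo) y ->
  0 < e -> exists2 k, (N <= k)%N & dot (x k - y) (x k - y) < e.
Proof.
move=> /(_ (x @` [set k | (N <= k)%N]) [set u | dot (u - y) (u - y) < e]) xy e0.
have [||_ [[k Nk <-] ke]] := xy; last by exists k.
- by exists N => // k /= Nk; exists k.
- apply: (cvgr_lt _ (@continuous_dot_sub _ _ y y)).
  by rewrite subrr dot0l.
Qed.

(** Opial's argument in finite dimension: the sequence is bounded, hence has a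
    cluster point; the distance to that point is nonincreasing and takes
    arbitrarily small values. *)
Lemma fejer_cvg (S : set 'rV[R]_n) : S !=set0 ->
  (forall s k, S s ->
    dot (x k.+1 - s) (x k.+1 - s) <= dot (x k - s) (x k - s)) ->
  cluster (x @ \oo) `<=` S -> exists2 y, S y & x @ \oo --> y.
Proof.
move=> [s Ss] xS clS.
have mono y m k : S y -> (m <= k)%N ->
    dot (x k - y) (x k - y) <= dot (x m - y) (x m - y).
  move=> Sy mk; rewrite -(subnK mk); elim: (k - m)%N => // j; apply: le_trans.
  exact: xS.
have [|y [_ cly]] := compact_ball2 s (dot (x 0%N - s) (x 0%N - s)) (x @ \oo) _.
  by exists 0%N => // k _; exact: mono.
exists y; first exact: clS.
apply: cvg_dotxx0; apply/cvgr0Pnorm_lt => e e0.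
have [N _ Ne] := cluster_often _ 0%N _ cly e0.
exists N => // k /= Nk; rewrite ger0_norm ?dotxx_ge0//.
exact: le_lt_trans (mono _ _ _ (clS _ cly) Nk) Ne.
Qed.

End fejer.

(** * The forward-backward iteration *)

Section forward_backward.
Context {R : realType} {n : nat} (f : 'rV[R]_n -> R) (P : 'rV[R]_n -> \bar R).
Context (rho sigma alpha : R).
Context (f_diff : forall x, differentiable f x).
Context (f_sconvex : convex_function [set: convex_lmodType 'rV[R]_n]
  (fun x : 'rV[R]_n => f x - rho / 2 * norm2 x ^+ 2)).
Context (sigma_gt0 : 0 < sigma).
Context (f_lip : forall x y : 'rV[R]_n,
  norm2 (gradient f x - gradient f y) <= sigma * norm2 (x - y)).
Context (alpha_gt0 : 0 < alpha).

(** Strong convexity and the descent inequality place the excess of [f] over its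
    tangent along [e] between [rho / 2 |e|^2] and [sigma / 2 |e|^2]; a nonzero [e]
    exists because [0 < n]. *)
Lemma modulus_le_lipschitz : (0 < n)%N -> rho <= sigma.
Proof.
move=> n0; pose e : 'rV[R]_n := delta_mx 0 (Ordinal n0).
have := @gradient_ineq _ _ f rho sigma f_diff f_sconvex sigma_gt0 f_lip 0 e.
have := descent f sigma 0 e sigma_gt0 f_diff f_lip.
suff : 0 < dot e e by move=> e0 H1 H2; rewrite -(ler_pM2r e0); lra.
apply: lt_le_trans (sqr_coord_le_dotxx e (Ordinal n0)).
by rewrite mxE !eqxx expr1n.
Qed.

Context (alpha_rho : alpha * rho < 1).

(** With [p = x - y], [w = y - s], [b = alpha / (1 - alpha rho)] and [d] the
    increment of the gradient of [f - rho / 2 |.|^2] from [s] to [x],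
    monotonicity of weak subgradients reads [b <d, w> <= <p, w>], and
    cocoercivity bounds [<d, w>] from below by [b k / 2 |d|^2 - <d, p>].
    Completing the square [|b k d - p|^2] leaves [- |p|^2 <= 2 k <p, w>]; the
    claim is this inequality after expanding [|x - s|^2 = |p + w|^2]. *)
Lemma forward_backward_fejer (k : R) (x y s : 'rV[R]_n) :
  k = 2 - (sigma - rho) * (alpha / (1 - alpha * rho)) / 2 ->
  weak_subgradient rho P y (- (alpha^-1 *: (y - (x - alpha *: gradient f x)))) ->
  weak_subgradient rho P s (- gradient f s) ->
  0 < k ->
  k * dot (y - s) (y - s) <= k * dot (x - s) (x - s) - (k - 1) * dot (x - y) (x - y).
Proof.
move=> kE wy ws k0.
have q0 : 0 < 1 - alpha * rho by rewrite subr_gt0.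
have bE : alpha = alpha / (1 - alpha * rho) * (1 - alpha * rho) by rewrite divfK ?gt_eqF.
set b := alpha / _ in bE kE *.
have b0 : 0 < b by rewrite divr_gt0.
have := weak_subgradient_monotone _ _ _ _ _ _ wy ws.
pose w := y - s; pose p := x - y.
pose d := gradient f (s + (x - s)) - gradient f s - rho *: (x - s).
have xsE : x - s = p + w by rewrite /p /w addrA subrK.
rewrite -/w -/p.
have -> : - (alpha^-1 *: (y - (x - alpha *: gradient f x))) - - gradient f s
    = alpha^-1 *: p - rho *: p - rho *: w - d.
  rewrite opprK !scalerBr scalerA mulVf ?gt_eqF// scale1r /d [s + _]addrC subrK /p /w.
  move: (gradient f x) (gradient f s) => gx gs.
  by apply/rowP => i; rewrite !mxE; lra.
(* tau = b / 2 turns the factor of |d|^2 into b * k / 2, also if sigma = rho *)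
have := cocoercive f rho sigma f_diff f_sconvex sigma_gt0 f_lip s (x - s) d (b / 2) erefl.
rewrite xsE; move: d w p {wy ws xsE} => d w p.
have := dotxx_ge0 ((b * k) *: d - p).
rewrite !dotE (dotC p d) (dotC w p).
move: (dot d d) (dot d p) (dot d w) (dot p w) (dot p p) (dot w w)
  => dd dp dw pw pp ww square coco mono.
have pw_ge : b * dw <= pw.
  rewrite -(ler_pM2l q0) -subr_ge0.
  have : 0 <= alpha * (alpha^-1 * pw - rho * pw - dw).
    by apply: mulr_ge0; [exact: ltW|lra].
  rewrite !mulrBr mulVKf ?gt_eqF// {2}bE; lra.
have dw_ge : b * k / 2 * dd - dp <= dw by rewrite kE; lra.
have : 2 * k * (b * (b * k / 2 * dd - dp)) <= 2 * k * pw.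
  by rewrite ler_pM2l ?mulr_gt0//; apply: le_trans pw_ge; rewrite ler_pM2l.
lra.
Qed.

End forward_backward.

Theorem proposition6 (R : realType) (n : nat)
    (f : 'rV[R]_n -> R) (P : 'rV[R]_n -> \bar R) (rho sigma alpha : R)
    (f_diff : forall x, differentiable f x)
    (rho_ge0 : 0 <= rho)
    (f_proper : proper_function (EFin \o f))
    (f_lsc : lower_semicontinuous (EFin \o f))
    (P_proper : proper_function P)
    (P_lsc : lower_semicontinuous P)
    (P_wconvex : weakly_convex rho P)
    (f_sconvex : convex_function [set: convex_lmodType 'rV[R]_n]
       (fun x : 'rV[R]_n => f x - rho / 2 * norm2 x ^+ 2))
    (sigma_gt0 : 0 < sigma)
    (f_lip : forall x y : 'rV[R]_n,
       norm2 (gradient f x - gradient f y) <= sigma * norm2 (x - y))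
    (D_min : minimizers (fun x => (f x)%:E + P x)%E !=set0)
    (alpha_gt0 : 0 < alpha)
    (alpha_lt : alpha < 2 / (sigma + rho))
    (x0 : 'rV[R]_n) (x : nat -> 'rV[R]_n)
    (x_init : x 0%N = x0)
    (x_step : forall k : nat,
       x k.+1 = threshold P alpha (x k - alpha *: gradient f (x k))) :
  exists2 xs : 'rV[R]_n,
    minimizers (fun x => (f x)%:E + P x)%E xs & x @ \oo --> xs.
Proof.
have [xs0 xs0min] := D_min.
case: (posnP n) => [n0|n_gt0].
  (* the space is a point, and [alpha * rho < 1] may fail *)
  subst n; exists xs0 => //.
  rewrite (_ : x = fun=> xs0); first exact: cvg_cst.
  by apply/funext => k; rewrite [x k]thinmx0 [xs0]thinmx0.
have rs := modulus_le_lipschitz f rho sigma f_diff f_sconvex sigma_gt0 f_lip n_gt0.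
have as2 : alpha * (sigma + rho) < 2.
  by rewrite -ltr_pdivlMr// ltr_wpDr.
have ar1 : alpha * rho < 1 by nra.
pose L := sigma - rho; pose b := alpha / (1 - alpha * rho).
pose k := 2 - L * b / 2.
have k1 : 1 < k.
  have q0 : 0 < 1 - alpha * rho by rewrite subr_gt0.
  by rewrite /k /b /L mulrA ltrBrDr -ltrBrDl ltr_pdivrMr// ltr_pdivrMr//; lra.
have grad_ineq := @gradient_ineq _ _ f rho sigma f_diff f_sconvex sigma_gt0 f_lip.
have wsub s : minimizers (fun x => (f x)%:E + P x)%E s ->
    weak_subgradient rho P s (- gradient f s).
  move=> smin.
  exact: (weak_subgradient_of_minimizer rho P f s _ (sigma / 2) P_proper P_wconvex smin
    (fun e => descent f sigma s e sigma_gt0 f_diff f_lip)).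
pose v j := - (alpha^-1 *: (x j.+1 - (x j - alpha *: gradient f (x j)))).
have vE j : v j = alpha^-1 *: (x j - x j.+1) - gradient f (x j).
  by rewrite /v -scalerN opprB addrAC scalerBr scalerA mulVf ?gt_eqF// scale1r.
have wv j : weak_subgradient rho P (x j.+1) (v j).
  rewrite /v x_step.
  exact: (threshold_weak_subgradient _ _ _ P_proper P_lsc alpha_gt0 ar1 _ _ _
    P_wconvex (wsub _ xs0min)).
have k0 : 0 < k := lt_trans ltr01 k1.
have fejer s j : minimizers (fun x => (f x)%:E + P x)%E s ->
    k * dot (x j.+1 - s) (x j.+1 - s) <= k * dot (x j - s) (x j - s)
      - (k - 1) * dot (x j - x j.+1) (x j - x j.+1).
  move=> /wsub ws.
  exact: (forward_backward_fejer f P rho sigma alpha f_diff f_sconvex sigma_gt0 f_lip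
    alpha_gt0 ar1 k _ _ _ erefl (wv j) ws k0).
have mono s j : minimizers (fun x => (f x)%:E + P x)%E s ->
    dot (x j.+1 - s) (x j.+1 - s) <= dot (x j - s) (x j - s).
  move=> smin; rewrite -(ler_pM2l k0); apply: le_trans (fejer _ _ smin) _.
  by rewrite gerBl mulr_ge0 ?dotxx_ge0// subr_ge0 ltW.
(* the decrease of [|x_j - xs0|^2] at each step dominates [|x_j - x_(j+1)|^2] *)
have p0 : dot (x j - x j.+1) (x j - x j.+1) @[j --> \oo] --> 0.
  pose a j := dot (x j - xs0) (x j - xs0).
  have ca : cvgn a.
    apply: nonincreasing_is_cvgn.
      by apply/nonincreasing_seqP => j; exact: (mono _ _ xs0min).
    by exists 0 => _ [j _ <-]; exact: dotxx_ge0.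
  have a0 : k / (k - 1) * (a j - a j.+1) @[j --> \oo] --> 0.
    rewrite -(mulr0 (k / (k - 1))) -(subrr (limn a)).
    apply: cvgM; first exact: (cvg_cst _).
    apply: cvgB => //.
    by rewrite (cvg_shiftS a).
  apply: (squeeze_cvgr _ (cvg_cst 0) a0); apply: nearW => j.
  rewrite dotxx_ge0 /= mulrAC ler_pdivlMr ?subr_gt0//.
  by have := fejer _ j xs0min; rewrite /a; lra.
apply: (fejer_cvg x (minimizers (fun x => (f x)%:E + P x)%E)) => // y cly.
(* [phi] need not be increasing: [j <= phi j] is enough for convergence along
   [x \o phi] *)
have often j : exists i, (j <= i)%N /\ dot (x i - y) (x i - y) < j.+1%:R^-1.
  have [|i ji ilt] := cluster_often x y j (j.+1%:R^-1) cly; first by rewrite invr_gt0.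
  by exists i.
have /choice[phi phiP] := often.
have phi_oo : phi @ \oo --> \oo.
  by apply/cvgnyPge => N; exists N => // j /= Nj; exact: leq_trans Nj (phiP j).1.
have xphi : x (phi j) @[j --> \oo] --> y.
  apply: cvg_dotxx0; apply: (squeeze_cvgr _ (cvg_cst 0) cvg_harmonic).
  by apply: nearW => j; rewrite dotxx_ge0 ltW//; exact: (phiP j).2.
have pphi : x (phi j) - x (phi j).+1 @[j --> \oo] --> (0 : 'rV[R]_n).
  apply: cvg_dotxx0; under eq_fun do rewrite subr0.
  exact: (cvg_comp _ _ phi_oo p0).
have xSphi : x (phi j).+1 @[j --> \oo] --> y.
  rewrite -[y]subr0.
  under eq_fun => j do rewrite -[x (phi j).+1](subKr (x (phi j))).
  exact: (cvgB xphi pphi).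
have gphi : gradient f (x (phi j)) @[j --> \oo] --> gradient f y.
  apply: cvg_dotxx0.
  have : sigma ^+ 2 * dot (x (phi j) - y) (x (phi j) - y) @[j --> \oo] --> 0.
    rewrite -(mulr0 (sigma ^+ 2)); exact: (cvgM (cvg_cst _) (cvg_dot_sub _ _ xphi)).
  apply: squeeze_cvgr (cvg_cst 0); apply: nearW => j.
  rewrite dotxx_ge0 -!sqr_norm2 -exprMn /= lerXn2r ?nnegrE ?sqrtr_ge0//.
  by rewrite mulr_ge0 ?sqrtr_ge0// ltW.
have vphi : v (phi j) @[j --> \oo] --> - gradient f y.
  rewrite -[- gradient f y]add0r -(scaler0 _ alpha^-1).
  under eq_fun do rewrite (vE (phi _)).
  exact: (cvgB (cvgZr pphi) gphi).
apply: (minimizer_of_weak_subgradient rho P f y (gradient f y)); last exact: grad_ineq.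
by apply: (weak_subgradient_closed rho P _ _ _ _ P_proper.1 P_lsc xSphi vphi) => j.
Qed.
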